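(* Suppose $g$ is convex. Then a stopping strategy $\hat{\mathbf p}\in[0,1]^N$ is an equilibrium if and only if, for each $x\in E$, the following two inequalities hold and at least one of them holds with equality: (1) $\phi_{\hat{\mathbf p}}(x)+g(\psi_{\hat{\mathbf p}}(x))\ge f(x)+g(h(x))$; (2) $\phi_{\hat{\mathbf p}}(x)+g(\psi_{\hat{\mathbf p}}(x))\ge \mathbb E_x(\phi_{\hat{\mathbf p}}(X_1))+g\big(\mathbb E_x(\psi_{\hat{\mathbf p}}(X_1))\big)$.
   Context: Setting: $E$ is a finite set with $N$ elements and $X=(X_n)_{n\in\mathbb N_0}$ is a time-homogeneous Markov chain on $E$; under $\mathbb P_x$ (expectation $\mathbb E_x$) one has $X_0=x$ a.s. The chain is absorbing: from every $x\in E$ some absorbing state is reached with positive probability in finitely many steps. $(Y_n)_{n\in\mathbb N_0}$ are i.i.d. uniform on $[0,1]$ and independent of $X$. $f,h:E\to\mathbb R$ are functions and $g:\mathbb R\to\mathbb R$ is continuous. Vectors in $\mathbb R^N$ are identified with functions on $E$: $\mathbf p=(p_x)_{x\in E}$. A (mixed) stopping strategy is a vector $\mathbf p\in[0,1]^N$; its stopping time is $\tau_{\mathbf p}=\min\{n\ge0: Y_n\le p_{X_n}\}$ ($=\infty$ if there is no such $n$). Convention: on $\{\tau=\infty\}$, $f(X_\tau):=\lim_{n\to\infty}f(X_n)$ and $h(X_\tau):=\lim_{n\to\infty}h(X_n)$ (the limits exist a.s. because $X$ is absorbing). Notation: $\phi_{\mathbf p}(x)=\mathbb E_x(f(X_{\tau_{\mathbf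 p}}))$, $\psi_{\mathbf p}(x)=\mathbb E_x(h(X_{\tau_{\mathbf p}}))$, $J_{\mathbf p}(x)=\phi_{\mathbf p}(x)+g(\psi_{\mathbf p}(x))$. A stopping strategy $\hat{\mathbf p}$ is an equilibrium if for all $q\in[0,1]$ and all $x\in E$, $$J_{\hat{\mathbf p}}(x)\ge q f(x)+(1-q)\mathbb E_x(\phi_{\hat{\mathbf p}}(X_1))+g\big(q h(x)+(1-q)\mathbb E_x(\psi_{\hat{\mathbf p}}(X_1))\big).$$ *)

(* Defs.v *)
From HB Require Import structures.
From mathcomp Require Export all_boot all_order all_algebra.
From mathcomp Require Export all_classical all_reals all_analysis.

Set Implicit Arguments.
Unset Strict Implicit.
Unset Printing Implicit Defensive.

Import Order.TTheory GRing.Theory Num.Theory.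
Import numFieldNormedType.Exports.

Local Open Scope classical_set_scope.
Local Open Scope ring_scope.

Section process.
Context {R : realType} {d : measure_display} {Omega : measurableType d}
  {E : finType}.
Implicit Types (P : E -> probability Omega R) (X : nat -> Omega -> E)
  (Y : nat -> {mfun Omega >-> R}) (p : E -> R).

(* The event {X_0 = s 0, ..., X_n = s n}. *)
Definition history X (n : nat) (s : nat -> E) : set Omega :=
  [set w | forall i, (i <= n)%N -> X i w = s i].

Definition transition P X (x y : E) : \bar R := P x [set w | X 1%N w = y].

(* [P x] plays the role of the law P_x.  The last clause is
   P_x(X_(n+1) = y | X_0 = s 0, ..., X_n = s n) = transition (s n) y, multiplied
   by the probability of the conditioning event, so that histories of
   probability zero need not be excluded; that the kernel does not depend on n
   (nor on x) is time-homogeneity. *)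
Definition markov_chain P X : Prop :=
  [/\ forall n (A : set E), measurable (X n @^-1` A),
      forall x, P x [set w | X 0%N w = x] = 1%E
    & forall x n (s : nat -> E) y,
        P x (history X n s `&` [set w | X n.+1 w = y])
        = (P x (history X n s) * transition P X (s n) y)%E].

Definition absorbing_state P X (a : E) : Prop := transition P X a a = 1%E.

Definition absorbing P X : Prop :=
  forall x, exists a n, absorbing_state P X a /\ (0 < P x [set w | X n w = a])%E.

Definition mutually_independent (Q : probability Omega R) Y : Prop :=
  forall (s : seq nat) (B : nat -> set R), uniq s ->
    (forall i, measurable (B i)) ->
    Q (\bigcap_(i in [set` s]) (Y i @^-1` B i))
    = (\prod_(i <- s) Q (Y i @^-1` B i))%E.

Definition iid_uniform (Q : probability Omega R) Y : Prop :=
  mutually_independent Q Y /\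
  forall n (B : set R), measurable B ->
    distribution Q (Y n) B = uniform_prob (@ltr01 R) B.

Definition sigma_X X : set (set Omega) :=
  <<s [set C | exists n (A : set E), C = X n @^-1` A] >>.

Definition sigma_Y Y : set (set Omega) :=
  <<s [set C | exists n (B : set R), measurable B /\ C = Y n @^-1` B] >>.

Definition independent_processes (Q : probability Omega R) X Y : Prop :=
  forall A B, sigma_X X A -> sigma_Y Y B -> Q (A `&` B) = (Q A * Q B)%E.

Definition stopping_strategy p : Prop := forall x, 0 <= p x <= 1.

(* [None] encodes the value infinity. *)
Definition stop_time X Y p (w : Omega) : option nat :=
  match pselect (exists n, Y n w <= p (X n w)) with
  | left stops => Some (ex_minn stops)
  | right _ => None
  end.

Definition stopped_value X Y (u : E -> R) p (w : Omega) : R :=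
  if stop_time X Y p w is Some n then u (X n w)
  else lim (u (X n w) @[n --> \oo]).

(* phi_p is [payoff P X Y f p] and psi_p is [payoff P X Y h p]; the integrand
   is almost surely bounded, so the expectation is finite. *)
Definition payoff P X Y (u : E -> R) p (x : E) : R :=
  fine 'E_(P x)[stopped_value X Y u p].

Definition one_step P X (v : E -> R) (x : E) : R :=
  fine 'E_(P x)[fun w => v (X 1%N w)].

Definition total_payoff P X Y (f h : E -> R) (g : R -> R) p (x : E) : R :=
  payoff P X Y f p x + g (payoff P X Y h p x).

Definition equilibrium P X Y (f h : E -> R) (g : R -> R) p : Prop :=
  forall (q : R) (x : E), 0 <= q <= 1 ->
    total_payoff P X Y f h g p x
    >= q * f x + (1 - q) * one_step P X (payoff P X Y f p) x
       + g (q * h x + (1 - q) * one_step P X (payoff P X Y h p) x).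

End process.

(* Main.v *)
Require Import Defs.
From mathcomp Require Import measurable_realfun lra.
Import Order.TTheory GRing.Theory Num.Theory.
Import numFieldNormedType.Exports.
Local Open Scope classical_set_scope.
Local Open Scope ring_scope.

Set Implicit Arguments.
Unset Strict Implicit.
Unset Printing Implicit Defensive.

(* Conditioning on the first step gives
   [phi_p x = p x * f x + (1 - p x) * E_x (phi_p X_1)], and likewise for [psi_p].
   Convexity of [g] therefore bounds the right-hand side of the equilibrium
   inequality by the convex combination of the stopping and the continuation
   payoff, and with [q = p x] that combination bounds the value [J_p x] itself:
   the maximum of the two payoffs, being at most [J_p x], must be attained.

   The first-step equation is obtained from the truncated payoffs
   [E_x (f (X_(min (tau, m))))], which satisfy it by backward induction on finite
   histories; they converge to [phi_p x] by dominated convergence because an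
   absorbing chain is almost surely eventually constant. *)

(** * Measurability of pointwise limits of bounded sequences *)

Section limits_of_sequences.

(** Each term lies between the infimum and the supremum of its own tail, and these two bounds
    squeeze [v]. *)
Lemma bounded_limn_sup_eq_inf (R : realType) (v : R ^nat) : bounded_fun v ->
  limn_sup v = limn_inf v -> v @ \oo --> limn_sup v.
Proof.
move=> bv eq_sup_inf.
have ubv : has_ubound (range v) by exact: bounded_fun_has_ubound.
have lbv : has_lbound (range v) by exact: bounded_fun_has_lbound.
have v_sdrop n : sdrop v n (v n) by exists n => /=.
apply: (@squeeze_cvgr _ _ _ _ (infs v) (sups v)).
- apply: nearW => n; apply/andP; split.
  + by apply: ge_inf; [exact: has_lbound_sdrop|exact: v_sdrop].
  + by apply: ub_le_sup; [exact: has_ubound_sdrop|exact: v_sdrop].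
- by rewrite eq_sup_inf limn_infE//; exact: cvg_infs_sup.
- by rewrite limn_supE//; exact: cvg_sups_inf.
Qed.

(* Off the convergence set [lim] takes the junk value [point]; that set is
   measurable since it is where the superior and inferior limits agree. *)
Lemma measurable_fun_limn (R : realType) d (T : measurableType d)
    (v : (T -> R) ^nat) :
  (forall n, measurable_fun setT (v n)) ->
  (forall x, bounded_fun (v ^~ x)) ->
  measurable_fun setT (fun x => limn (v ^~ x)).
Proof.
move=> mv bv.
have ub x : [set: T] x -> has_ubound (range (v ^~ x)).
  by move=> _; exact: bounded_fun_has_ubound.
have lb x : [set: T] x -> has_lbound (range (v ^~ x)).
  by move=> _; exact: bounded_fun_has_lbound.
have msup : measurable_fun setT (fun x => limn_sup (v ^~ x)).
  exact: measurable_fun_limn_sup.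
have minf : measurable_fun setT (fun x => limn_inf (v ^~ x)).
  (* Negation exchanges inferior and superior limits, so the measurability of superior limits
     applies to the negated sequence. *)
  rewrite (_ : (fun _ => _) = \- (fun x => limn_sup (fun n => - v n x))); last first.
    apply/funext => x /=; rewrite /limn_sup -[in RHS]/(-%R \o (v ^~ x)).
    rewrite supsN limN ?opprK//.
    by apply/cvg_ex; eexists; exact: cvg_infs_sup (ub x I) (lb x I).
  apply: measurableT_comp => //.
  apply: (@measurable_fun_limn_sup _ _ _ _ (fun n => \- v n)) => [x _|x _|n].
  - have [M /= hM] := lb x I; exists (- M) => _ [n _ <-].
    by rewrite lerN2; apply: hM; exists n.
  - have [M /= hM] := ub x I; exists (- M) => _ [n _ <-].
    by rewrite lerN2; apply: hM; exists n.
  - exact: measurableT_comp.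
rewrite (_ : (fun x => limn _) = fun x => if limn_sup (v ^~ x) == limn_inf (v ^~ x)
    then limn_sup (v ^~ x) else point); last first.
  apply/funext => x; case: eqP => [eq_sup_inf|neq].
    by apply: cvg_lim => //; exact: bounded_limn_sup_eq_inf.
  have [cv|dv] := pselect (cvgn (v ^~ x)); last first.
    rewrite /lim/= /lim_in/=; case: xgetP => // l _ /= vl.
    by exfalso; apply: dv; apply/cvg_ex; exists l.
  by exfalso; apply: neq; have [-> ->] := cvg_limn_inf_sup (cvgP _ cv).
apply: measurable_fun_ifT => //.
exact: measurable_fun_eqr.
Qed.

End limits_of_sequences.

(** * Random variables with values in a finite set *)

Section finite_state.
Context {R : realType} {d : measure_display} {Omega : measurableType d}
  {E : finType}.
Implicit Types (Q : probability Omega R) (Z : Omega -> E) (u : E -> R).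

Lemma measurable_fun_finite Z u : (forall A, measurable (Z @^-1` A)) ->
  measurable_fun setT (u \o Z).
Proof. by move=> mZ _ B _; rewrite setTI; exact: (mZ (u @^-1` B)). Qed.

Lemma bounded_finite u : exists M, forall y, `|u y| <= M.
Proof.
by exists (\sum_y `|u y|) => y; rewrite (bigD1 y)//= lerDl sumr_ge0.
Qed.

Lemma finite_total_probability Q Z (A : set Omega) :
  (forall B, measurable (Z @^-1` B)) -> measurable A ->
  fine (Q A) = \sum_y fine (Q (A `&` [set w | Z w = y])).
Proof.
move=> mZ mA.
have mAZ y : measurable (A `&` [set w | Z w = y]).
  by apply: measurableI => //; exact: (mZ [set y]).
have eqA : A = \bigcup_(y in [set` enum E]) (A `&` [set w | Z w = y]).
  apply/seteqP; split => [w Aw|w [y _ []//]].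
  by exists (Z w) => //=; rewrite mem_enum.
rewrite {1}eqA measure_fin_bigcup//; first last.
  by move=> y z _ _ [w [[_ <-] [_ <-]]].
rewrite -fsbig_seq ?enum_uniq// big_enum/=.
rewrite (eq_bigr (fun y => (fine (Q (A `&` [set w | Z w = y])))%:E)) ?sumEFin//.
by move=> y _; rewrite fineK// fin_num_measure.
Qed.

Lemma expectation_finite Q Z u : (forall A, measurable (Z @^-1` A)) ->
  'E_Q[u \o Z]%E = (\sum_y u y * fine (Q [set w | Z w = y]))%:E.
Proof.
move=> mZ; rewrite unlock.
have uZ w : (u (Z w))%:E = (\sum_y (u y)%:E * (\1_[set w | Z w = y] w)%:E)%E.
  rewrite (bigD1 (Z w))//= big1 => [|y /eqP yZ].
    by rewrite indicE mem_set// mule1 adde0.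
  by rewrite indicE memNset ?mule0// => /esym.
under eq_integral do rewrite /= uZ.
rewrite integral_sum//=; last first.
  move=> y; apply: integrableZl => //.
  by apply: integrable_indic => //; exact: (mZ [set y]).
rewrite -sumEFin; apply: eq_bigr => y _.
rewrite integralZl//; last by apply: integrable_indic => //; exact: (mZ [set y]).
rewrite integral_indic//; last exact: (mZ [set y]).
by rewrite setIT EFinM fineK// fin_num_measure//; exact: (mZ [set y]).
Qed.

Lemma prob1_setI Q (A B : set Omega) : Q A = 1%E ->
  measurable A -> measurable B -> Q (A `&` B) = Q B.
Proof.
move=> A1 mA mB; rewrite (measureDI Q mB mA) setIC.
rewrite -[LHS]add0e; congr (_ + _)%E; apply/esym.
apply: (@subset_measure0 _ _ _ Q _ (~` A));
  [exact: measurableD|exact: measurableC|by move=> w []|].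
by have := probability_setC Q mA; rewrite A1 subee.
Qed.

End finite_state.

(** * The chain stopped at a truncated stopping time *)

Section stopped_chain.
Context {R : realType} {d : measure_display} {Omega : measurableType d}
  {E : finType}.
Variables (X : nat -> Omega -> E) (stops : nat -> E -> set Omega).

(* [X] at the first stop at or after time [j], truncated at time [j + m]. *)
Fixpoint truncated_stop (m j : nat) (w : Omega) : E :=
  if m is m'.+1 then
    if `[< stops j (X j w) w >] then X j w else truncated_stop m' j.+1 w
  else X j w.

(** The stops are tested at the prescribed states [s i], not at [X i w]: when stopping is decided by
    [Y], the second event concerns [Y] alone and independence applies. A stop at time [n] itself is
    left open. *)
Definition running (n : nat) (s : nat -> E) : set Omega :=
  history X n s `&` [set w | forall i, (i < n)%N -> ~ stops i (s i) w].

(** Without stops the construction gives back the plain chain, so results on the stopped chain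
    specialise to [X] itself. *)
Lemma running_set0 n s : (forall i z, stops i z = set0) ->
  running n s = history X n s.
Proof.
move=> stops0; apply/seteqP; split=> [w []//|w hw].
by split=> // i _; rewrite stops0.
Qed.

Lemma truncated_stop_set0 m j w :
  (forall i z, stops i z = set0) -> truncated_stop m j w = X (j + m)%N w.
Proof.
move=> stops0; elim: m j => [|m IH] j /=; first by rewrite addn0.
by rewrite asboolF ?stops0// IH addSnnS.
Qed.

Lemma truncated_stop_at m j k w : (j <= k < j + m)%N ->
  (forall i, (j <= i < k)%N -> ~ stops i (X i w) w) -> stops k (X k w) w ->
  truncated_stop m j w = X k w.
Proof.
elim: m j => [|m IH] j /=.
  by rewrite addn0 => /andP[jk kj]; move: (leq_ltn_trans jk kj); rewrite ltnn.
move=> /andP[jk km] before at_k; case: asboolP => [stop_j|go_j].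
  move: jk; rewrite leq_eqVlt => /predU1P[-> //|jk].
  by exfalso; apply: (before j) => //; rewrite leqnn.
apply: IH => //; last by move=> i /andP[/ltnW ji ik]; apply: before; rewrite ji.
rewrite addSnnS km andbT ltn_neqAle jk andbT.
by apply/eqP => jk'; apply: go_j; rewrite jk'.
Qed.

Lemma truncated_stop_never m j w :
  (forall i, (j <= i)%N -> ~ stops i (X i w) w) ->
  truncated_stop m j w = X (j + m)%N w.
Proof.
elim: m j => [|m IH] j never /=; first by rewrite addn0.
rewrite asboolF; last exact: never.
by rewrite IH ?addSnnS// => i /ltnW; exact: never.
Qed.

Hypothesis mX : forall n (A : set E), measurable (X n @^-1` A).
Hypothesis mstops : forall n z, measurable (stops n z).

Lemma measurable_stops_now n : measurable [set w | stops n (X n w) w].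
Proof.
rewrite (_ : [set _ | _] =
    \bigcup_(z in [set: E]) (X n @^-1` [set z] `&` stops n z)).
  apply: fin_bigcup_measurable => [|z _]; first exact: finite_finset.
  exact: measurableI.
apply/seteqP; split => [w sw|w [z _ [/= <-]]//].
by exists (X n w).
Qed.

Lemma measurable_truncated_stop m j (A : set E) :
  measurable (truncated_stop m j @^-1` A).
Proof.
elim: m j => [|m IH] j /=; first exact: mX.
rewrite (_ : _ @^-1` _ =
  ([set w | stops j (X j w) w] `&` X j @^-1` A) `|`
  (~` [set w | stops j (X j w) w] `&` truncated_stop m j.+1 @^-1` A)).
  have mS := measurable_stops_now j.
  by apply: measurableU; apply: measurableI => //; exact: measurableC.
apply/seteqP; split => w /=; rewrite /preimage/=; case: asboolP => sw.
- by left.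
- by right.
- by case=> [[]|[]].
- by case=> [[]|[]].
Qed.

Lemma measurable_history n s : measurable (history X n s).
Proof.
rewrite (_ : history X n s =
    \bigcap_(i in [set i | (i <= n)%N]) X i @^-1` [set s i]).
  by apply: bigcap_measurable => //; exists 0%N => /=.
by apply/seteqP; split => w hw i; exact: hw.
Qed.

Lemma measurable_running n s : measurable (running n s).
Proof.
apply: measurableI; first exact: measurable_history.
rewrite (_ : [set _ | _] = \bigcap_(i in [set i | (i < n)%N]) ~` stops i (s i)).
  by apply: bigcap_measurableType => i _; exact: measurableC.
by apply/seteqP; split => w hw i; exact: hw.
Qed.

Definition extend (n : nat) (s : nat -> E) (z : E) (i : nat) : E :=
  if i == n then z else s i.

Lemma eq_running n s s' : (forall i, (i <= n)%N -> s i = s' i) ->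
  running n s = running n s'.
Proof.
move=> ss'; apply/seteqP; split=> w [hw nw]; split.
- by move=> i ik; rewrite hw// ss'.
- by move=> i ik /=; rewrite -ss' ?(ltnW ik)//; exact: nw.
- by move=> i ik; rewrite hw// ss'.
- by move=> i ik /=; rewrite ss' ?(ltnW ik)//; exact: nw.
Qed.

Lemma running_extend n s z : running n.+1 (extend n.+1 s z) =
  running n s `&` ~` stops n (s n) `&` [set w | X n.+1 w = z].
Proof.
have ext i : (i <= n)%N -> extend n.+1 s z i = s i.
  by rewrite /extend; case: eqP => // ->; rewrite ltnn.
apply/seteqP; split=> w.
  move=> [hw nw]; split; last by rewrite /= hw// /extend eqxx.
  split; last by rewrite -[s n]ext//; exact: nw.
  split=> i ik; first by rewrite hw ?ext// ltnW.
  by rewrite -ext ?(ltnW ik)//; apply: nw; exact: ltnW.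
move=> [[[hw nw] sn] Xz]; split=> i.
  rewrite leq_eqVlt => /predU1P[->|ik]; first by rewrite Xz /extend eqxx.
  by rewrite ext// hw.
rewrite ltnS => ik; rewrite ext//; move: ik; rewrite leq_eqVlt => /predU1P[-> //|].
exact: nw.
Qed.

(** The two hypotheses say that, given a running history ending in [z], a stop has probability
    [c z], and after no stop the next state has law [t z]. The plain chain is the case [c = 0], the
    strategy the case [c = p]. *)
Variables (Q : probability Omega R) (c : E -> R) (t : E -> E -> R).
Hypothesis prob_stop : forall n s,
  fine (Q (running n s `&` stops n (s n))) = fine (Q (running n s)) * c (s n).
Hypothesis prob_continue : forall n s,
  fine (Q (running n.+1 s)) =
  fine (Q (running n s)) * (1 - c (s n)) * t (s n) (s n.+1).

Definition stop_operator (u v : E -> R) (z : E) : R :=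
  c z * u z + (1 - c z) * \sum_y t z y * v y.

(* The sum is the expectation of the stopped payoff on the event [running n s].
   That event splits according to whether the chain stops at time [n] and, if
   not, according to the value of [X n.+1]. *)
Lemma prob_running_truncated_stop (u : E -> R) m n s :
  \sum_y u y * fine (Q (running n s `&` [set w | truncated_stop m n w = y])) =
  fine (Q (running n s)) * iter m (stop_operator u) u (s n).
Proof.
(* On an event where [Z] is constant only one term survives. This settles both the truncation time
   and a stop at time [n]. *)
have sum_at z (A : set Omega) (Z : Omega -> E) : (forall w, A w -> Z w = z) ->
    \sum_y u y * fine (Q (A `&` [set w | Z w = y])) = fine (Q A) * u z.
  move=> Zz; rewrite (bigD1 z)//= big1 => [|y yz].
    by rewrite addr0 mulrC setIidl.
  rewrite (_ : A `&` _ = set0) ?measure0 ?mulr0//.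
  apply/seteqP; split => // w [Aw /= Zw].
  by move: yz; rewrite -Zw Zz// eqxx.
elim: m n s => [|m IH] n s.
  by apply: sum_at => w [hw _]; exact: hw.
set A := running n s; set S := stops n (s n).
have mA : measurable A by exact: measurable_running.
have mS : measurable S by exact: mstops.
have mT y : measurable [set w | truncated_stop m.+1 n w = y].
  exact: (measurable_truncated_stop m.+1 n [set y]).
have Xn w : A w -> X n w = s n by case=> hw _; exact: hw.
have split_stop y : fine (Q (A `&` [set w | truncated_stop m.+1 n w = y])) =
    fine (Q (A `&` S `&` [set w | truncated_stop m.+1 n w = y])) +
    \sum_z fine (Q (running n.+1 (extend n.+1 s z) `&`
                    [set w | truncated_stop m n.+1 w = y])).
  rewrite (measureDI Q _ mS); last exact: measurableI.
  rewrite fineD ?fin_num_measure//; last first.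
  - by apply: measurableI => //; exact: measurableI.
  - by apply: measurableD => //; exact: measurableI.
  rewrite addrC setIAC; congr (_ + _).
  rewrite (finite_total_probability Q (mX n.+1)); last first.
    by apply: measurableD => //; exact: measurableI.
  apply: eq_bigr => z _; congr (fine (Q _)); rewrite running_extend.
  apply/seteqP; split=> w /=.
    by move=> [[[Aw Tw] nw] Xz]; rewrite asboolF ?Xn in Tw.
  move=> [[[Aw nw] Xz] Ty]; split=> //; split=> //; split=> //=.
  by rewrite asboolF ?Xn.
under eq_bigr do rewrite split_stop mulrDr mulr_sumr.
rewrite big_split/= exchange_big/= (sum_at (s n)); last first.
  by move=> w [Aw Sw] /=; rewrite asboolT Xn.
rewrite prob_stop /stop_operator mulrDr !mulrA; congr (_ + _).
rewrite mulr_sumr; apply: eq_bigr => z _.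
have -> : \sum_y u y * fine (Q (running n.+1 (extend n.+1 s z) `&`
      [set w | truncated_stop m n.+1 w = y])) =
    fine (Q (running n.+1 (extend n.+1 s z))) * iter m (stop_operator u) u z.
  by rewrite IH /extend eqxx.
(* The extended path agrees with [s] up to time [n], so the event of running until [n] is the same
   for both. *)
rewrite prob_continue (@eq_running n (extend n.+1 s z) s) => [|i ik].
  by rewrite /extend eqxx ltn_eqF// !mulrA.
by rewrite /extend ltn_eqF.
Qed.

(** At time 0 the running event for the constant path [x] is the almost sure event that [X] starts
    at [x], so intersecting with it changes no probability. *)
Lemma expectation_truncated_stop (u : E -> R) m x :
  Q [set w | X 0%N w = x] = 1%E ->
  'E_Q[u \o truncated_stop m 0%N]%E = (iter m (stop_operator u) u x)%:E.
Proof.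
move=> X0; have running0 : running 0%N (fun=> x) = [set w | X 0%N w = x].
  apply/seteqP; split=> [w [hw _]|w Xw]; first exact: hw.
  by split=> i //; rewrite leqn0 => /eqP ->.
rewrite expectation_finite; last exact: measurable_truncated_stop.
have := prob_running_truncated_stop u m 0%N (fun=> x).
rewrite running0 X0 mul1r => <-; congr (_%:E).
apply: eq_bigr => y _; congr (_ * fine _).
have mT : measurable [set w | truncated_stop m 0%N w = y].
  exact: (measurable_truncated_stop m 0%N [set y]).
by rewrite (prob1_setI X0)//; exact: (mX 0%N [set x]).
Qed.

End stopped_chain.

(** * Decay of the transient mass of a finite absorbing chain *)

Section absorption.
Context {R : realType} {E : finType}.
Variables (t : E -> E -> R) (absorbed : pred E).
Hypothesis t_ge0 : forall z y, 0 <= t z y.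
Hypothesis t_sum1 : forall z, \sum_y t z y = 1.
Hypothesis t_absorbed : forall a, absorbed a -> t a a = 1.

Definition chain_operator (v : E -> R) (z : E) : R := \sum_y t z y * v y.

Let T := chain_operator.
(** With [t] as transition matrix, [iter n T u z] is the probability that the chain from [z] is not
    in an absorbed state at time [n]. *)
Let u (z : E) : R := (~~ absorbed z)%:R.

Let T_le v v' : (forall y, v y <= v' y) -> forall z, T v z <= T v' z.
Proof. by move=> vv' z; apply: ler_sum => y _; exact: ler_wpM2l. Qed.

Let iterT_le n v v' : (forall y, v y <= v' y) ->
  forall z, iter n T v z <= iter n T v' z.
Proof. by move=> vv'; elim: n => [|n IH]//= ; exact: T_le. Qed.

Let iterTZ n k v z : iter n T (fun y => k * v y) z = k * iter n T v z.
Proof.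
elim: n z => [|n IH] z //=; rewrite /T /chain_operator mulr_sumr.
by apply: eq_bigr => y _; rewrite IH mulrCA.
Qed.

(** [u] is superharmonic, which makes its iterates decrease: no mass leaves an absorbed state,
    because the diagonal entry 1 exhausts its row; elsewhere [u] is 1. *)
Let Tu_le z : T u z <= u z.
Proof.
rewrite /T /chain_operator /u; case: (boolP (absorbed z)) => /= [az|_].
  have := t_sum1 z; rewrite (bigD1 z)//= (t_absorbed az) -[RHS]addr0 => /addrI tz0.
  rewrite (bigD1 z)//= az mulr0 add0r.
  apply: (@le_trans _ _ 0); last exact: ler0n.
  rewrite -[leRHS]tz0; apply: ler_sum => y _.
  by rewrite ler_piMr// lern1 leq_b1.
rewrite -[leRHS](t_sum1 z); apply: ler_sum => y _.
by rewrite ler_piMr// lern1 leq_b1.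
Qed.

Let iterT_ge0 n z : 0 <= iter n T u z.
Proof.
elim: n z => [|n IH] z /=; first by rewrite /u ler0n.
by apply: sumr_ge0 => y _; exact: mulr_ge0.
Qed.

Let iterT_decr z : nonincreasing_seq (fun n => iter n T u z).
Proof.
by apply/nonincreasing_seqP => n; rewrite iterSr; apply: iterT_le; exact: Tu_le.
Qed.

(* The limit [l] of the decreasing sequence [T^n u] is harmonic and vanishes on
   absorbing states.  At a maximum point [x0] it satisfies
   [l x0 = T^n l x0 <= l x0 * T^n u x0], which forces [l x0 <= 0]. *)
Lemma cvg_iter_chain_operator_transient :
  (forall z, exists n, iter n T u z < 1) ->
  forall z, iter n T u z @[n --> \oo] --> (0 : R).
Proof.
move=> reach z.
pose l y := limn (fun n => iter n T u y).
have cvl y : iter n T u y @[n --> \oo] --> l y.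
  apply: nonincreasing_is_cvgn; first exact: iterT_decr.
  by exists 0 => _ [n _ <-].
have l_ge0 y : 0 <= l y.
  by apply: limr_ge; [exact: cvl|exact: nearW].
have Tl y : T l y = l y.
  have c1 : iter n.+1 T u y @[n --> \oo] --> l y.
    by have := cvl y; rewrite -(cvg_shiftS (fun n => iter n T u y)).
  apply/esym; apply: (cvg_unique _ c1) => //.
  apply: cvg_big => [|x _]; first exact: add_continuous.
  by apply: cvgM; [exact: cvg_cst|exact: cvl].
have iterTl n y : iter n T l y = l y.
  by elim: n y => //= n IH y; rewrite -[RHS]Tl; apply: eq_bigr => x _; rewrite IH.
have [x0 x0max] : exists x0, forall y, l y <= l x0.
  have [x0 _ x0max] := @arg_maxP _ _ _ z xpredT l isT.
  by exists x0 => y; exact: x0max.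
have l_le y : l y <= l x0 * u y.
  rewrite /u; case: (boolP (absorbed y)) => [ay|_]/=; last by rewrite mulr1 x0max.
  rewrite mulr0 (_ : l y = 0)//.
  apply: cvg_lim => //; apply: cvg_near_cst; apply: nearW => n.
  apply/eqP; rewrite eq_le iterT_ge0 andbT.
  by rewrite (le_trans (iterT_decr y (leq0n n)))//= /u ay.
have lx0 : l x0 <= 0.
  rewrite leNgt; apply/negP => lx0.
  have [n n1] := reach x0.
  have := iterT_le n l_le x0; rewrite iterTl iterTZ.
  by apply/negP; rewrite -ltNge gtr_pMr.
suff <- : l z = 0 by exact: cvl.
by apply/eqP; rewrite eq_le l_ge0 andbT (le_trans (x0max z)).
Qed.

End absorption.

(** * Almost sure absorption of the Markov chain *)

Section absorbing_chain.
Context {R : realType} {d : measure_display} {Omega : measurableType d}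
  {E : finType}.
Variables (P : E -> probability Omega R) (X : nat -> Omega -> E).
Hypothesis X_markov : markov_chain P X.

Definition transition_prob (z y : E) : R := fine (transition P X z y).

Let mX n (A : set E) : measurable (X n @^-1` A).
Proof. by case: X_markov. Qed.

Let X0 x : P x [set w | X 0%N w = x] = 1%E.
Proof. by case: X_markov. Qed.

Lemma transition_prob_ge0 z y : 0 <= transition_prob z y.
Proof. by apply: fine_ge0; exact: measure_ge0. Qed.

Lemma transition_prob_sum1 z : \sum_y transition_prob z y = 1.
Proof.
have := finite_total_probability (P z) (mX 1%N) measurableT.
rewrite probability_setT/= => ->.
by apply: eq_bigr => y _; rewrite setTI.
Qed.

Lemma history_extend n s z : history X n.+1 (extend n.+1 s z) =
  history X n s `&` [set w | X n.+1 w = z].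
Proof.
by rewrite -!(@running_set0 _ _ _ _ (fun _ _ => set0))// running_extend setC0 setIT.
Qed.

Lemma prob_history_step x n s y :
  fine (P x (history X n s `&` [set w | X n.+1 w = y])) =
  fine (P x (history X n s)) * transition_prob (s n) y.
Proof.
case: X_markov => _ _ ->; rewrite fineM ?fin_num_measure//.
- exact: measurable_history.
- exact: (mX 1%N [set y]).
Qed.

Lemma prob_historyS x n s : fine (P x (history X n.+1 s)) =
  fine (P x (history X n s)) * transition_prob (s n) (s n.+1).
Proof.
rewrite -prob_history_step; congr (fine (P x _)).
apply/seteqP; split=> [w hw|w [hw Xw] i].
  by split=> [i ik|]; apply: hw => //; exact: ltnW.
by rewrite leq_eqVlt => /predU1P[->//|]; exact: hw.
Qed.

(** This is the stopped chain with empty stops and [c = 0], for which [stop_operator] reduces to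
    [chain_operator]. *)
Lemma expectation_chain x n (u : E -> R) :
  'E_(P x)[u \o X n]%E = (iter n (chain_operator transition_prob) u x)%:E.
Proof.
have eX : X n = truncated_stop X (fun _ _ => set0) n 0.
  by apply/funext => w; rewrite truncated_stop_set0// add0n.
rewrite eX (@expectation_truncated_stop _ _ _ _ X _ mX _ (P x) (fun=> 0)
  transition_prob _ _ u n x (X0 x))//.
- congr (_%:E); congr (_ x); apply: eq_iter => v; apply/funext => z.
  by rewrite /stop_operator mul0r add0r subr0 mul1r.
- by move=> m s; rewrite setI0 measure0 mulr0.
- by move=> m s; rewrite subr0 mulr1 !running_set0// prob_historyS.
Qed.

(** The induction drops the last state of the history by total probability, until only the initial
    state remains, which is almost surely [x]. *)
Lemma null_of_null_histories x n (A : set Omega) : measurable A ->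
  (forall s, fine (P x (history X n s `&` A)) = 0) -> P x A = 0%E.
Proof.
move=> mA; elim: n => [|n IH] null_hist.
  rewrite -(prob1_setI (X0 x) (mX 0%N [set x]) mA).
  have <- : history X 0 (fun=> x) = [set w | X 0%N w = x].
    by apply/seteqP; split=> [w|w Xw i]; [exact|rewrite leqn0 => /eqP ->].
  rewrite -[LHS]fineK ?null_hist// fin_num_measure//.
  by apply: measurableI => //; exact: measurable_history.
apply: IH => s; rewrite (finite_total_probability (P x) (mX n.+1)).
  by apply: big1 => z _; rewrite setIAC -history_extend null_hist.
by apply: measurableI => //; exact: measurable_history.
Qed.

Let leaves n : set Omega :=
  [set w | absorbing_state P X (X n w) /\ X n.+1 w <> X n w].

Let measurable_leaves n : measurable (leaves n).
Proof.
rewrite (_ : leaves n = \bigcup_(a in absorbing_state P X)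
    (X n @^-1` [set a] `&` X n.+1 @^-1` (~` [set a]))).
  apply: fin_bigcup_measurable => [|a _]; first exact: finite_finset.
  exact: measurableI.
apply/seteqP; split=> [w [abs_w Xw]|w [a abs_a [/= Xa Xa']]].
  by exists (X n w).
by split; rewrite /= Xa.
Qed.

(** [absorbing_state] concerns only the first step from the state itself; the Markov property on
    each history ending in such a state carries it over to time [n]. *)
Lemma absorbing_state_stays x n : P x (leaves n) = 0%E.
Proof.
apply: (null_of_null_histories (n := n)) => // s.
have mH := measurable_history mX n s.
have [abs_s|not_abs] := pselect (absorbing_state P X (s n)); last first.
  rewrite (_ : _ `&` _ = set0) ?measure0//.
  by apply/seteqP; split=> // w [hw]; rewrite /leaves/= (hw n)// => -[].
have mXs : measurable [set w | X n.+1 w = s n] by exact: (mX n.+1 [set s n]).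
have := measureDI (P x) mH mXs.
move=> /(congr1 fine); rewrite fineD ?fin_num_measure//; first last.
- exact: measurableI.
- exact: measurableD.
rewrite prob_history_step /transition_prob abs_s mulr1 -[LHS]add0r.
move=> /addIr stays; rewrite [RHS]stays; congr (fine (P x _)).
by apply/seteqP; split=> w [hw]; rewrite /leaves/= (hw n)// => -[].
Qed.

Hypothesis X_absorbing : absorbing P X.

(** Two null events are discarded: never being in an absorbing state, and leaving one at some time.
    Any other path is constant from a visit to an absorbing state on. *)
Lemma absorbing_eventually_constant x :
  {ae P x, forall w, exists n, forall k, (n <= k)%N -> X k w = X n w}.
Proof.
pose absorbed a := `[< absorbing_state P X a >].
pose transient n := X n @^-1` [set a | ~~ absorbed a].
have mtransient n : measurable (transient n) by exact: mX.
have prob_transient n z : P z (transient n) =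
    (iter n (chain_operator transition_prob) (fun y => (~~ absorbed y)%:R) z)%:E.
  rewrite -expectation_chain -expectation_indic//; congr ('E_(P z)[_])%E.
  apply/funext => w; rewrite /= indicE.
  suff -> : (w \in transient n) = ~~ absorbed (X n w) by [].
  by apply/idP/idP; rewrite in_setE.
have t_abs a : absorbed a -> transition_prob a a = 1.
  by move/asboolP; rewrite /transition_prob => ->.
have cvg0 : (P x (transient n)) @[n --> \oo] --> 0%E.
  under eq_fun do rewrite prob_transient.
  apply: cvg_EFin; first exact: nearW.
  apply: cvg_iter_chain_operator_transient => //.
  - exact: transition_prob_ge0.
  - exact: transition_prob_sum1.
  (* A positive probability of being in the absorbing state [a] at time [n] keeps the transient
     probability at that time below 1. *)
  move=> z; have [a [n [abs_a an]]] := X_absorbing z; exists n.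
  have mXa : measurable [set w | X n w = a] by exact: (mX n [set a]).
  rewrite -lte_fin -prob_transient.
  apply: (@le_lt_trans _ _ (P z (~` [set w | X n w = a]))).
    apply: le_measure; rewrite ?inE//; first exact: measurableC.
    move=> w tw Xa; move: tw; rewrite /transient /preimage/= Xa => /negP; apply.
    exact/asboolP.
  rewrite probability_setC//; move: an.
  rewrite -(@fineK _ (P z _)) ?fin_num_measure// -EFinB !lte_fin.
  by rewrite ltrBlDr ltrDl.
have never : P x (\bigcap_n transient n) = 0%E.
  have mcap : measurable (\bigcap_n transient n) by exact: bigcap_measurableType.
  apply/eqP; rewrite eq_le measure_ge0 andbT.
  apply: (cvge_ge _ cvg0).
  apply: nearW => n; apply: le_measure; rewrite ?inE//.
  by move=> w; exact.
have null_never : (P x).-negligible (\bigcap_n transient n).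
  by apply/negligibleP => //; exact: bigcap_measurableType.
have null_leaves : (P x).-negligible (\bigcup_n leaves n).
  apply: negligible_bigcup => n.
  by apply/negligibleP; [exact: measurable_leaves|exact: absorbing_state_stays].
apply: negligibleS (negligibleU null_leaves null_never).
move=> w moves; apply: contrapT => /not_orP[no_leave absorbs]; apply: moves.
move: absorbs => /existsNP[n /not_implyP[_ /negP]]; rewrite negbK => /asboolP abs_n.
exists n => k; elim: k => [|k IH]; first by rewrite leqn0 => /eqP ->.
rewrite leq_eqVlt => /predU1P[<- //|]; rewrite ltnS => nk.
rewrite -(IH nk); apply: contrapT => Xk; apply: no_leave; exists k => //.
by split => //; rewrite IH.
Qed.

End absorbing_chain.

(** * First-step equation for the payoff of a stopping strategy *)

Section stopping_strategy_payoff.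
Context {R : realType} {d : measure_display} {Omega : measurableType d}
  {E : finType}.
Variables (P : E -> probability Omega R) (X : nat -> Omega -> E)
  (Y : nat -> {mfun Omega >-> R}).
Hypotheses (X_markov : markov_chain P X) (X_absorbing : absorbing P X).
Hypothesis Y_iid : forall x, iid_uniform (P x) Y.
Hypothesis XY_indep : forall x, independent_processes (P x) X Y.

Let mX n (A : set E) : measurable (X n @^-1` A).
Proof. by case: X_markov. Qed.

Let mY n (B : set R) : measurable B -> measurable (Y n @^-1` B).
Proof. by move=> mB; rewrite -[_ @^-1` _]setTI; exact: measurable_funP. Qed.

Lemma prob_uniform_le x n (a : R) : 0 <= a <= 1 ->
  P x (Y n @^-1` `]-oo, a]) = a%:E.
Proof.
move=> /andP[a0 a1]; have [_ /(_ n _ (measurable_itv `]-oo, a]))] := Y_iid x.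
rewrite /distribution/= /pushforward => ->.
rewrite /uniform_prob integral_uniform_pdf.
rewrite (_ : _ `&` _ = `[0, a]%classic); last first.
  apply/seteqP; split=> r /=; rewrite !in_itv/=.
    by move=> [ra /andP[-> _]].
  by move=> /andP[-> ra]; split=> //=; exact: le_trans a1.
rewrite (eq_integral (cst 1%E)) => [|r].
  rewrite integral_cst//= mul1e lebesgue_measure_itv/= lte_fin.
  by case: ltgtP a0 => // [_|<-] _; rewrite ?sube0.
rewrite inE/= in_itv/= /uniform_pdf => /andP[r0 ra].
by rewrite r0 (le_trans ra a1) subr0 invr1.
Qed.

Lemma sigma_X_history n s : sigma_X X (history X n s).
Proof.
have mXi i : (<<s [set C | exists n (A : set E), C = X n @^-1` A] >>)
    (X i @^-1` [set s i]).
  by apply: sub_sigma_algebra; exists i, [set s i].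
(* Taking [Omega] with the generated sigma-algebra as a measurable space turns membership in
   [sigma_X] into measurability. *)
have := @bigcap_measurableType _ (g_sigma_algebraType
  [set C | exists n (A : set E), C = X n @^-1` A])
  (fun i => X i @^-1` [set s i]) [set i | (i <= n)%N].
rewrite (_ : \bigcap_(_ in _) _ = history X n s).
  by apply=> i _; exact: mXi.
by apply/seteqP; split=> w hw i; exact: hw.
Qed.

Definition cylinder (B : nat -> set R) (m : nat) : set Omega :=
  [set w | forall i, (i < m)%N -> B i (Y i w)].

Lemma cylinderE B m :
  cylinder B m = \bigcap_(i in [set` iota 0 m]) (Y i @^-1` B i).
Proof.
apply/seteqP; split=> w hw i; first by rewrite /= mem_iota add0n; exact: hw.
by move=> im; apply: hw; rewrite /= mem_iota add0n.
Qed.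

Lemma sigma_Y_cylinder B m : (forall i, measurable (B i)) ->
  sigma_Y Y (cylinder B m).
Proof.
move=> mB; have mYi i : (<<s [set C | exists n (B : set R),
    measurable B /\ C = Y n @^-1` B] >>) (Y i @^-1` B i).
  by apply: sub_sigma_algebra; exists i, (B i).
have := @bigcap_measurableType _ (g_sigma_algebraType
  [set C | exists n (B : set R), measurable B /\ C = Y n @^-1` B])
  (fun i => Y i @^-1` B i) [set i | (i < m)%N].
rewrite (_ : \bigcap_(_ in _) _ = cylinder B m).
  by apply=> i _; exact: mYi.
by apply/seteqP; split=> w hw i; exact: hw.
Qed.

(** Independence of [X] and [Y] splits off the history; mutual independence within [Y] then factors
    the cylinder. *)
Lemma prob_history_cylinder x n s m B (b : nat -> R) :
  (forall i, measurable (B i)) -> (forall i, P x (Y i @^-1` B i) = (b i)%:E) ->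
  fine (P x (history X n s `&` cylinder B m)) =
  fine (P x (history X n s)) * \prod_(0 <= i < m) b i.
Proof.
move=> mB Bb; rewrite XY_indep; last exact: sigma_Y_cylinder.
  rewrite cylinderE; have [indep _] := Y_iid x.
  rewrite indep ?iota_uniq// (eq_bigr (fun i => (b i)%:E)) => [|i _]; last exact: Bb.
  rewrite prodEFin fineM ?fin_num_measure//; last exact: measurable_history.
  by rewrite /index_iota subn0.
exact: sigma_X_history.
Qed.

Variable p : E -> R.
Hypothesis p_strategy : stopping_strategy p.

Let stops (n : nat) (z : E) : set Omega := Y n @^-1` `]-oo, p z].

Let mstops n z : measurable (stops n z).
Proof. exact: mY. Qed.

Let prob_stops x n z : P x (stops n z) = (p z)%:E.
Proof. exact: prob_uniform_le. Qed.

Let prob_not_stops x n z : P x (~` stops n z) = (1 - p z)%:E.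
Proof. by rewrite probability_setC// prob_stops. Qed.

Let runningE n s :
  running X stops n s = history X n s `&` cylinder (fun i => ~` `]-oo, p (s i)]) n.
Proof. by []. Qed.

Let prob_running x n s : fine (P x (running X stops n s)) =
  fine (P x (history X n s)) * \prod_(0 <= i < n) (1 - p (s i)).
Proof.
rewrite runningE; apply: prob_history_cylinder => i; first exact: measurableC.
exact: prob_not_stops.
Qed.

(** Together with [prob_runningS], this supplies the hypotheses [prob_stop] and [prob_continue] of
    the stopped chain for [c = p]. *)
Lemma prob_running_stops x n s :
  fine (P x (running X stops n s `&` stops n (s n))) =
  fine (P x (running X stops n s)) * p (s n).
Proof.
(* Going on before time [n] and stopping at [n] form a single cylinder of length [n.+1], whose last
   factor is [p (s n)]. *)
pose B i : set R := if i == n then `]-oo, p (s i)]%classic else ~` `]-oo, p (s i)].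
pose b i := if i == n then p (s i) else 1 - p (s i).
have -> : running X stops n s `&` stops n (s n) = history X n s `&` cylinder B n.+1.
  rewrite runningE -setIA; congr (_ `&` _); apply/seteqP; split=> w.
    move=> [go stop] i; rewrite ltnS leq_eqVlt /B; case: eqP => [-> _//|_ /=].
    exact: go.
  move=> hw; split; last by have := hw n (leqnn _); rewrite /B eqxx.
  by move=> i ik; have := hw i (ltnW ik); rewrite /B ltn_eqF.
rewrite (prob_history_cylinder _ _ _ (b := b)) => [|i|i].
- rewrite prob_running big_nat_recr//= mulrA {2}/b eqxx; congr (_ * _ * _).
  by apply: eq_big_nat => i /andP[_ ik]; rewrite /b ltn_eqF.
- by rewrite /B; case: ifP => _ //; exact: measurableC.
- by rewrite /B /b; case: ifP => _; [exact: prob_stops|exact: prob_not_stops].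
Qed.

Lemma prob_runningS x n s : fine (P x (running X stops n.+1 s)) =
  fine (P x (running X stops n s)) * (1 - p (s n)) *
  transition_prob P X (s n) (s n.+1).
Proof.
by rewrite !prob_running (prob_historyS X_markov) big_nat_recr//= mulrAC !mulrA.
Qed.

Let stopped (m : nat) : Omega -> E := truncated_stop X stops m 0.

(* The first part also covers the paths on which the limit does not exist: both
   sides are then the same junk value. *)
Lemma stopped_value_limn (u : E -> R) w :
  stopped_value X Y u p w = limn (fun m => u (stopped m w)) /\
  ((exists n, forall k, (n <= k)%N -> X k w = X n w) ->
   cvgn (fun m => u (stopped m w))).
Proof.
rewrite /stopped_value /stop_time; case: pselect => [ex_stop|never].
  case: ex_minnP => n stop_n min_n.
  have cst_stopped : \forall m \near \oo, u (stopped m w) = u (X n w).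
    (* A truncation of length [m] tests only the times below [m], so [m] must exceed [n] for the
       stop at [n] to be seen. *)
    exists n.+1 => // m /= nm; congr u.
    apply: truncated_stop_at => [|i /andP[_ ik]|] /=.
    - by rewrite add0n.
    - rewrite /stops/= in_itv/= => /min_n; by rewrite leqNgt ik.
    - by rewrite /stops/= in_itv.
  have cvg_stopped : u (stopped m w) @[m --> \oo] --> u (X n w).
    exact: cvg_near_cst.
  by split; [apply/esym/cvg_lim|move=> _; apply/cvg_ex; exists (u (X n w))].
have -> : (fun m => u (stopped m w)) = (fun m => u (X m w)).
  apply/funext => m; rewrite /stopped truncated_stop_never ?add0n// => i _.
  rewrite /stops/= in_itv/= => stop_i.
  by apply: never; exists i.
split=> // -[n cst_X]; apply/cvg_ex; exists (u (X n w)); apply: cvg_near_cst.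
by exists n => // m /= nm; rewrite cst_X.
Qed.

Lemma cvg_payoff (u : E -> R) x :
  iter m (stop_operator p (transition_prob P X) u) u x @[m --> \oo] -->
  payoff P X Y u p x.
Proof.
have [M uM] := bounded_finite u.
have mstopped m : measurable_fun setT (u \o stopped m).
  by apply: measurable_fun_finite => A; exact: measurable_truncated_stop.
have mV : measurable_fun setT (stopped_value X Y u p).
  rewrite (_ : stopped_value X Y u p = fun w => limn (fun m => u (stopped m w))).
    apply: (@measurable_fun_limn _ _ _ (fun m => u \o stopped m)) => // w.
    exists M; split=> [|M' MM' m _]; first exact: num_real.
    by apply: (le_trans (uM (stopped m w))); exact: ltW.
  by apply/funext => w; have [] := stopped_value_limn u w.
have := @dominated_convergence _ _ _ (P x) setT measurableT
  (fun m => EFin \o (u \o stopped m)) (EFin \o stopped_value X Y u p) (cst M%:E).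
case=> //.
- by move=> m; exact/measurable_EFinP.
- exact/measurable_EFinP.
- apply: filterS (absorbing_eventually_constant X_markov X_absorbing x).
  move=> w cst_X _; have [eqV /(_ cst_X) cvg_w] := stopped_value_limn u w.
  rewrite /= eqV.
  by apply: cvg_EFin; [exact: nearW|exact: cvg_w].
- exact: finite_measure_integrable_cst.
- by apply: aeW => w m _ /=; rewrite lee_fin; exact: uM.
move=> intV _ cvgV.
have expectE m : ('E_(P x)[u \o stopped m])%E =
    (iter m (stop_operator p (transition_prob P X) u) u x)%:E.
  apply: (expectation_truncated_stop mX mstops (prob_running_stops x)
    (prob_runningS x)).
  by case: X_markov.
have {}cvgV : (iter m (stop_operator p (transition_prob P X) u) u x)%:E
    @[m --> \oo] --> (payoff P X Y u p x)%:E.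
  (* Integrability of the limit, part of dominated convergence, makes the expectation finite, so
     [fine] in [payoff] loses nothing. *)
  rewrite /payoff unlock fineK; last exact: integrable_fin_num intV.
  under eq_fun do rewrite -expectE unlock.
  exact: cvgV.
exact: fine_cvg cvgV.
Qed.

Lemma one_stepE (v : E -> R) x :
  one_step P X v x = \sum_y transition_prob P X x y * v y.
Proof.
rewrite /one_step (expectation_finite _ _ (mX 1%N))/=.
by apply: eq_bigr => y _; rewrite mulrC.
Qed.

(** Iterate [m.+1] is [stop_operator] applied to iterate [m]; the state space being finite, the
    limit passes through the operator, and limits are unique. *)
Lemma payoff_recursion (u : E -> R) x : payoff P X Y u p x =
  p x * u x + (1 - p x) * one_step P X (payoff P X Y u p) x.
Proof.
have := @cvg_payoff u x.
rewrite -(cvg_shiftS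
  (fun m => iter m (stop_operator p (transition_prob P X) u) u x)).
move=> /cvg_unique; apply => //; rewrite one_stepE.
apply: cvgD; first exact: cvg_cst.
apply: cvgM; first exact: cvg_cst.
apply: cvg_big => [|y _]; first exact: add_continuous.
by apply: cvgM; [exact: cvg_cst|exact: cvg_payoff].
Qed.

End stopping_strategy_payoff.

(** * Convexity of [g] and the characterisation of equilibria *)

Lemma convex_function_le (R : realType) (g : R -> R) (q a b : R) :
  convex_function [set: R^o] g -> 0 <= q <= 1 ->
  g (q * a + (1 - q) * b) <= q * g a + (1 - q) * g b.
Proof.
move=> g_convex /andP[q0 q1].
have := g_convex (Itv01 q0 q1) a b; rewrite !inE => /(_ I I).
by rewrite !convRE.
Qed.

Theorem corollary3p4 (R : realType) (d : measure_display)
    (Omega : measurableType d) (E : finType)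
    (P : E -> probability Omega R)
    (X : nat -> Omega -> E) (Y : nat -> {mfun Omega >-> R})
    (f h : E -> R) (g : R -> R)
    (X_markov : markov_chain P X)
    (X_absorbing : absorbing P X)
    (Y_iid : forall x, iid_uniform (P x) Y)
    (XY_indep : forall x, independent_processes (P x) X Y)
    (g_cont : continuous g)
    (g_convex : convex_function [set: R^o] g)
    (p : E -> R) (p_strategy : stopping_strategy p) :
  equilibrium P X Y f h g p <->
  forall x : E,
    let J := payoff P X Y f p x + g (payoff P X Y h p x) in
    let stop := f x + g (h x) in
    let continue := one_step P X (payoff P X Y f p) x
                    + g (one_step P X (payoff P X Y h p) x) in
    [/\ J >= stop, J >= continue & J = stop \/ J = continue].
Proof.
have recursion u x :=
  payoff_recursion X_markov X_absorbing Y_iid XY_indep p_strategy u x.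
split=> [eq_p x /=|ineq q x q01].
  have ge_stop : payoff P X Y f p x + g (payoff P X Y h p x) >= f x + g (h x).
    (* The choice [q = 1] is immediate stopping; [q = 0] below is continuation. *)
    have := eq_p 1 x; rewrite ler01 lexx /total_payoff subrr !mul1r !mul0r !addr0.
    by apply.
  have ge_continue : payoff P X Y f p x + g (payoff P X Y h p x) >=
      one_step P X (payoff P X Y f p) x + g (one_step P X (payoff P X Y h p) x).
    have := eq_p 0 x; rewrite ler01 lexx /total_payoff subr0 !mul1r !mul0r !add0r.
    by apply.
  split=> //; have := convex_function_le (h x) (one_step P X (payoff P X Y h p) x)
    g_convex (p_strategy x).
  (* The recursion for [h] turns the argument of [g] into psi at [x]; with the one for [f], the
     value at [x] is at most the mean of both payoffs with weights [p x] and [1 - p x]. *)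
  rewrite -recursion; have := recursion f x; have /andP[p0 p1] := p_strategy x.
  move: ge_stop ge_continue => + + phi_eq convex_le.
  (* The larger payoff dominates this mean, hence the value, which in turn is at least that
     payoff. *)
  have [stop_le|/ltW continue_le] :=
    leP (f x + g (h x))
        (one_step P X (payoff P X Y f p) x + g (one_step P X (payoff P X Y h p) x)).
    by move=> _ ge_continue; right; apply/le_anti/andP; split=> //; nra.
  by move=> ge_stop _; left; apply/le_anti/andP; split=> //; nra.
(* Convexity bounds the payoff of a deviation [q] by the [q]-weighted mean of two quantities that
   are each at most the value. *)
have [ge_stop ge_continue _] := ineq x.
have := convex_function_le (h x) (one_step P X (payoff P X Y h p) x) g_convex q01.
rewrite /total_payoff; case/andP: q01 => q0 q1.
move: ge_stop ge_continue; nra.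
Qed.
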